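(* There is a constant $c>0$ such that for every $n\ge 2$ and every poset $P=(S,\preceq)$ with $|S|=n$, letting $G_r=(S,E_r)$ be the transitive reduction graph of $P$, there is a data structure representing $G_r$ that occupies at most $n^2/4 + c\,(n^2\lg\lg n)/\lg n$ bits and, given two elements $a,b\in S$, reports whether $(a,b)\in E_r$ in $O(1)$ time.
   Context: A poset $P=(S,\preceq)$ is a reflexive, antisymmetric, transitive binary relation on a finite set $S$; write $a\prec b$ if $a\preceq b$ and $a\ne b$. The transitive reduction graph of $P$ is the directed graph $G_r=(S,E_r)$ with $E_r=\{(a,b): a\prec b \text{ and there is no } c\in S \text{ with } a\prec c\prec b\}$. Here $\lg n=\lceil\log_2 n\rceil$. The model is the word-RAM with word size $\Theta(\lg n)$ bits; elements are identified by distinct integer labels in $\{1,\dots,n\}$; space is measured in bits. *)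

(* Defs.v *)
From mathcomp Require Import all_boot all_order all_algebra.

Set Implicit Arguments.
Unset Strict Implicit.
Unset Printing Implicit Defensive.

Import Order.TTheory.

(* Ceiling of the base-2 logarithm; in particular lg 1 = 0 and lg 2 = 1. *)
Definition lg (n : nat) : nat := up_log 2 n.

Definition trans_red (d : Order.disp_t) (T : finPOrderType d) : rel T :=
  fun a b => (a < b)%O && ~~ [exists c : T, (a < c)%O && (c < b)%O].

Definition labelling (n : nat) (T : Type) (lab : T -> nat) : Prop :=
  injective lab /\ forall x : T, 1 <= lab x <= n.

(* Word size Theta(lg n).  The lower constant is 2 because a word has to be able
   to address the order of n ^ 2 memory cells. *)
Definition word_size_Theta_lg (w : nat -> nat) : Prop :=
  (forall n, 2 <= n -> 2 * lg n <= w n) /\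
  exists K : nat, forall n, 2 <= n -> w n <= K * lg n.

(* Word-RAM with w-bit words: a word is a natural number below 2 ^ w and all the
   arithmetic is modulo 2 ^ w. *)

Inductive binop : Type :=
  OpAdd | OpSub | OpMul | OpDiv | OpMod | OpAnd | OpOr | OpXor | OpShl | OpShr.

Definition eval_binop (w : nat) (o : binop) (x y : nat) : nat :=
  (match o with
   | OpAdd => x + y
   | OpSub => x + (2 ^ w - y)
   | OpMul => x * y
   | OpDiv => x %/ y
   | OpMod => x %% y
   | OpAnd => Nat.land x y
   | OpOr => Nat.lor x y
   | OpXor => Nat.lxor x y
   | OpShl => x * 2 ^ y
   | OpShr => x %/ 2 ^ y
   end) %% 2 ^ w.

(* Arguments are register numbers, except the literal k of Const and the jump
   targets l, which are positions in the program. *)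
Inductive instr : Type :=
  | Const (r k : nat)               (* r := k *)
  | Binop (o : binop) (r x y : nat) (* r := x o y *)
  | Read (r x : nat)                (* r := M[x] *)
  | Write (x y : nat)               (* M[x] := y *)
  | JumpEq (x y l : nat)            (* if x = y goto l *)
  | JumpLt (x y l : nat)            (* if x < y goto l *)
  | Halt.

Definition program : Type := seq instr.

Record state : Type := State {
  pc : nat;
  regs : nat -> nat;
  mem : nat -> nat
}.

Definition upd (f : nat -> nat) (i v : nat) : nat -> nat :=
  fun j => if j == i then v else f j.

Definition exec (w : nat) (i : instr) (s : state) : state :=
  let R := regs s in
  let M := mem s in
  match i with
  | Const r k => State (pc s).+1 (upd R r (k %% 2 ^ w)) M
  | Binop o r x y => State (pc s).+1 (upd R r (eval_binop w o (R x) (R y))) M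
  | Read r x => State (pc s).+1 (upd R r (M (R x))) M
  | Write x y => State (pc s).+1 R (upd M (R x) (R y))
  | JumpEq x y l => State (if R x == R y then l else (pc s).+1) R M
  | JumpLt x y l => State (if R x < R y then l else (pc s).+1) R M
  | Halt => s
  end.

(* The final state if Halt is reached after executing at most t instructions;
   None on timeout or when the program counter leaves the program. *)
Fixpoint run (w : nat) (p : program) (t : nat) (s : state) : option state :=
  match onth p (pc s) with
  | Some Halt => Some s
  | Some i => if t is t'.+1 then run w p t' (exec w i s) else None
  | None => None
  end.

(* The bit string B laid out from address 0 on, w bits per word, least
   significant bit first; the rest of the memory is 0. *)
Definition pack (w : nat) (B : seq bool) : nat -> nat :=
  fun i => \sum_(j < w) nth false B (i * w + j) * 2 ^ j.

(* Besides the two query labels, the program only gets the length of the bit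
   string: neither n nor w is passed to it. *)
Definition query_state (w : nat) (B : seq bool) (x y : nat) : state :=
  State 0
    (fun r => match r with
              | 0 => size B %% 2 ^ w
              | 1 => x %% 2 ^ w
              | 2 => y %% 2 ^ w
              | _ => 0
              end)
    (pack w B).

(* Within t steps the query (x, y) leaves its answer, 1 or 0, in register 0 and
   the memory as it was, so that the structure can be queried again. *)
Definition answers (w : nat) (p : program) (t : nat) (B : seq bool)
    (x y : nat) (ans : bool) : Prop :=
  exists2 s : state, run w p t (query_state w B x y) = Some s &
    regs s 0 = ans /\ mem s =1 pack w B.

(* Main.v *)
(** The transitive reduction of a poset, with orientations forgotten, is
    triangle-free; the orientation of an edge is recovered by comparing the sizes
    of the down-sets of its ends.  In a triangle-free graph no vertex has neighbours
    on both sides of a biclique K_{q,q}, so q + 2 bits describe its adjacency to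
    these 2q vertices.  Removing disjoint bicliques greedily, and recording each
    pair only once, costs n^2 / 4 + O(n^2 / q) bits.  What remains contains no
    K_{q,q}; for q of order lg n / lg lg n a double count then leaves at most
    O(n^2 / lg^3 n) edges.  Every row is therefore cut into blocks of about lg^2 n
    bits that are reached through a table of pointers, all zero blocks being shared:
    this stores the remaining edges in o(n^2) bits and gives constant-time access. *)

Require Import Defs.
From mathcomp Require Import all_boot all_order all_algebra zify ring.

Set Implicit Arguments.
Unset Strict Implicit.
Unset Printing Implicit Defensive.

Import Order.TTheory GRing.Theory Num.Theory.
Local Open Scope ring_scope.

(** * Words and tables *)

Section Words.
Local Open Scope nat_scope.

Definition bit (x i : nat) : bool := odd (x %/ 2 ^ i).

Lemma bitS x i : bit x i.+1 = bit x./2 i.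
Proof. by rewrite /bit expnS divnMA divn2. Qed.

Definition word_of_bits (w : nat) (b : nat -> bool) : nat :=
  \sum_(j < w) b j * 2 ^ j.

Lemma word_of_bitsS w b :
  word_of_bits w.+1 b = b 0 + (word_of_bits w (fun j => b j.+1)).*2.
Proof.
rewrite /word_of_bits big_ord_recl /= muln1 -mul2n big_distrr /=; congr (_ + _).
by apply: eq_bigr => i _; rewrite expnS mulnCA.
Qed.

Lemma ltn_word_of_bits w b : word_of_bits w b < 2 ^ w.
Proof.
elim: w b => [|w IHw] b; first by rewrite /word_of_bits big_ord0.
by rewrite word_of_bitsS expnS; have := IHw (fun j => b j.+1); case: (b 0); lia.
Qed.

Lemma bit_word_of_bits w b i : i < w -> bit (word_of_bits w b) i = b i.
Proof.
elim: w b i => [//|w IHw] b [|i] lt_iw; rewrite word_of_bitsS.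
  by rewrite /bit divn1 oddD odd_double addbF oddb.
by rewrite bitS half_bit_double IHw.
Qed.

Lemma word_of_bits_bit w x : x < 2 ^ w -> word_of_bits w (bit x) = x.
Proof.
elim: w x => [|w IHw] x; first by case: x => //; rewrite /word_of_bits big_ord0.
rewrite expnS mul2n -[x in x < _]odd_double_half => lt_x.
rewrite word_of_bitsS {1}/bit divn1 -[RHS]odd_double_half -(IHw x./2); last by lia.
by congr (_ + _.*2); apply: eq_bigr => i _; rewrite bitS.
Qed.

Lemma divn_rowmajor m x y : y < m -> (x * m + y) %/ m = x.
Proof. by move=> lt_ym; rewrite /divn edivn_eq. Qed.

Lemma modn_rowmajor m x y : y < m -> (x * m + y) %% m = y.
Proof. by move=> lt_ym; rewrite modn_def edivn_eq. Qed.

Lemma ltn_rowmajor n m x y : x < n -> y < m -> x * m + y < n * m.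
Proof.
move=> lt_xn lt_ym; apply: (@leq_trans (x.+1 * m)).
  by rewrite mulSn addnC ltn_add2r.
by rewrite leq_mul2r lt_xn orbT.
Qed.

Definition table (m n : nat) (f : nat -> nat -> nat) : seq nat :=
  mkseq (fun i => f (i %/ n) (i %% n)) (m * n).

Lemma size_table m n f : size (table m n f) = m * n.
Proof. exact: size_mkseq. Qed.

Lemma nth_table m n f x y : x < m -> y < n -> nth 0 (table m n f) (x * n + y) = f x y.
Proof.
by move=> lt_xm lt_yn; rewrite nth_mkseq ?ltn_rowmajor // divn_rowmajor ?modn_rowmajor.
Qed.

Lemma all_table (P : pred nat) m n f :
  (forall x y, x < m -> y < n -> P (f x y)) -> all P (table m n f).
Proof.
move=> Pf; apply/allP => _ /mapP[i + ->]; rewrite mem_iota add0n => lt_i.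
have n_gt0 : 0 < n by case: n lt_i {Pf}; rewrite ?muln0.
by rewrite Pf ?ltn_mod ?ltn_divLR.
Qed.

Lemma nth_cat_addn (T : Type) (x0 : T) (s1 s2 : seq T) i :
  nth x0 (s1 ++ s2) (size s1 + i) = nth x0 s2 i.
Proof. by rewrite nth_cat ltnNge leq_addr addKn. Qed.

Definition row_word (w : nat) (b : nat -> bool) (i : nat) : nat :=
  word_of_bits w (fun j => b (i * w + j)).

Lemma bit_row_word w b o : 0 < w -> bit (row_word w b (o %/ w)) (o %% w) = b o.
Proof. by move=> w_gt0; rewrite bit_word_of_bits ?ltn_mod // -divn_eq. Qed.

Lemma ltn_pack w B i : pack w B i < 2 ^ w.
Proof. exact: (ltn_word_of_bits w (fun j => nth false B (i * w + j))). Qed.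

Definition bits_of_words (w : nat) (ws : seq nat) : seq bool :=
  mkseq (fun i => bit (nth 0 ws (i %/ w)) (i %% w)) (size ws * w).

Lemma size_bits_of_words w ws : size (bits_of_words w ws) = size ws * w.
Proof. exact: size_mkseq. Qed.

Lemma pack_bits_of_words w ws :
  all (ltn^~ (2 ^ w)) ws -> pack w (bits_of_words w ws) =1 nth 0 ws.
Proof.
move=> ws_lt i; have [le_i|lt_i] := leqP (size ws) i.
  rewrite nth_default //; apply: big1 => j _; rewrite nth_default //.
  by rewrite size_bits_of_words (leq_trans _ (leq_addr _ _)) // leq_mul2r le_i orbT.
rewrite -[RHS](@word_of_bits_bit w); last exact: (all_nthP 0 ws_lt).
apply: eq_bigr => j _.
by rewrite nth_mkseq ?ltn_rowmajor // divn_rowmajor ?modn_rowmajor.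
Qed.

End Words.

(** * The query program *)

Section Machine.
Local Open Scope nat_scope.
Variables (w : nat) (M : nat -> nat).

Definition straight_line (i : instr) : bool :=
  match i with Const _ _ | Binop _ _ _ _ | Read _ _ => true | _ => false end.

Definition exec_regs (R : nat -> nat) (i : instr) : nat -> nat :=
  regs (exec w i (State 0 R M)).

Definition exec_block (code : program) (R : nat -> nat) : nat -> nat :=
  foldl exec_regs R code.

Lemma run_straight_line (p code : program) t c R :
    take (size code) (drop c p) = code -> all straight_line code -> size code <= t ->
  run w p t (State c R M) =
    run w p (t - size code) (State (c + size code) (exec_block code R) M).
Proof.
elim: code t c R => [|i code IHcode] [|t] c R //=; rewrite ?addn0 //.
case def_p: (drop c p) => [//|j p'] [eq_ji def_code] /andP[sl_i sl_code] le_t.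
have onth_p : onth p c = Some i.
  rewrite -[p](cat_take_drop c) onth_cat size_take.
  have lt_cp : c < size p by move: (size_drop c p); rewrite def_p /=; lia.
  by rewrite lt_cp ltnn subnn def_p eq_ji.
have drop_p : drop c.+1 p = p' by rewrite -addn1 addnC -drop_drop def_p /= drop0.
rewrite onth_p subSS addnS -addSn -IHcode ?drop_p //.
by case: i sl_i {eq_ji onth_p}.
Qed.

Lemma run_halt p t c R : onth p c = Some Halt ->
  run w p t (State c R M) = Some (State c R M).
Proof. by case: t => [|t] /= ->. Qed.

Lemma run_jump_eq p t c R x y l : onth p c = Some (JumpEq x y l) ->
  run w p t.+1 (State c R M) = run w p t (State (if R x == R y then l else c.+1) R M).
Proof. by move=> /= ->. Qed.

Lemma run_jump_lt p t c R x y l : onth p c = Some (JumpLt x y l) ->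
  run w p t.+1 (State c R M) = run w p t (State (if R x < R y then l else c.+1) R M).
Proof. by move=> /= ->. Qed.

Lemma eval_add x y : x + y < 2 ^ w -> eval_binop w OpAdd x y = x + y.
Proof. exact: modn_small. Qed.

Lemma eval_mul x y : x * y < 2 ^ w -> eval_binop w OpMul x y = x * y.
Proof. exact: modn_small. Qed.

Lemma eval_div x y : x < 2 ^ w -> eval_binop w OpDiv x y = x %/ y.
Proof. by move=> lt_x; apply/modn_small/(leq_ltn_trans _ lt_x)/leq_div. Qed.

Lemma eval_mod x y : x < 2 ^ w -> eval_binop w OpMod x y = x %% y.
Proof. by move=> lt_x; apply/modn_small/(leq_ltn_trans _ lt_x)/leq_mod. Qed.

Lemma eval_shr x y : x < 2 ^ w -> eval_binop w OpShr x y = x %/ 2 ^ y.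
Proof. by move=> lt_x; apply/modn_small/(leq_ltn_trans _ lt_x)/leq_div. Qed.

Definition mem_bit (a o : nat) : bool := bit (M (a + o %/ w)) (o %% w).

Definition eval_fetch (a o : nat) : nat :=
  eval_binop w OpMod
    (eval_binop w OpShr (M (eval_binop w OpAdd a (eval_binop w OpDiv o w)))
                        (eval_binop w OpMod o w)) 2.

Hypothesis M_lt : forall i, M i < 2 ^ w.

Lemma eval_fetchE a o :
  o < 2 ^ w -> a + o %/ w < 2 ^ w -> eval_fetch a o = mem_bit a o.
Proof.
move=> lt_o lt_a; rewrite /eval_fetch eval_div // eval_add // !eval_mod //.
  by rewrite eval_shr // modn2.
by rewrite eval_shr // (leq_ltn_trans (leq_div _ _)).
Qed.

(* A row is a table of pointers to blocks of L bits. *)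
Definition row_bit (L row o : nat) : bool := mem_bit (M (row + o %/ L)) (o %% L).

Definition eval_row_fetch (L row o : nat) : nat :=
  eval_fetch (M (eval_binop w OpAdd row (eval_binop w OpDiv o L)))
             (eval_binop w OpMod o L).

Definition row_addressable (L row o : nat) : Prop :=
  [/\ o < 2 ^ w, row + o %/ L < 2 ^ w & M (row + o %/ L) + o %% L %/ w < 2 ^ w].

Lemma eval_row_fetchE L row o :
  row_addressable L row o -> eval_row_fetch L row o = row_bit L row o.
Proof.
case=> lt_o lt_ptr lt_word; rewrite /eval_row_fetch eval_div // eval_add // eval_mod //.
by rewrite eval_fetchE // (leq_ltn_trans (leq_mod _ _)).
Qed.

End Machine.

Section QueryProgram.
Local Open Scope nat_scope.

(* Registers 0, 1, 2 hold the size of the structure and the two labels; 3, 4, 5, 9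
   hold M[0], which is the word size unless the poset has two elements, and the
   constants 1, 2, 0. *)

Definition dispatch_code : program :=
  [:: Read 3 9; Const 4 1; Const 5 2; Read 6 4].

(* Sets register r to the bit at offset R[o] from address R[a]. *)
Definition fetch_code (r a o s : nat) : program :=
  [:: Binop OpDiv s o 3; Binop OpAdd a a s; Read a a;
      Binop OpMod o o 3; Binop OpShr a a o; Binop OpMod r a 5].

Definition matrix_code : program :=
  [:: Binop OpMul 6 1 6; Binop OpAdd 6 6 5] ++ fetch_code 0 6 2 7.

Definition swap_code : program :=
  [:: Binop OpAdd 6 1 9; Binop OpAdd 1 2 9; Binop OpAdd 2 6 9].

(* The words 4x, ..., 4x + 3 belong to label x: rank, row address, two columns. *)
Definition rank_code : program :=
  [:: Const 7 4; Binop OpMul 1 1 7; Binop OpMul 2 2 7; Read 10 1; Read 11 2].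

Definition row_address_code : program :=
  [:: Binop OpAdd 1 1 4; Binop OpAdd 2 2 4; Read 10 1; Read 11 2].

Definition swap_rows_code : program := [:: Binop OpAdd 10 11 9; Binop OpAdd 2 1 9].

Definition row_fetch_code (r o : nat) : program :=
  [:: Binop OpDiv 7 o 6; Binop OpAdd 7 10 7; Read 7 7; Binop OpMod o o 6]
  ++ fetch_code r 7 o 8.

Definition columns_code : program :=
  [:: Binop OpAdd 2 2 4; Read 11 2; Binop OpAdd 2 2 4; Read 12 2; Read 6 5]
  ++ row_fetch_code 13 11 ++ row_fetch_code 14 12 ++ [:: Binop OpMul 0 13 14].

Definition query_program : program :=
  dispatch_code ++ [:: JumpLt 3 5 15; JumpEq 6 9 22]
  (* 6: bit matrix *)
  ++ matrix_code ++ [:: Halt]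
  (* 15: two elements *)
  ++ [:: JumpEq 3 9 19] ++ swap_code
  (* 19: label order *)
  ++ [:: JumpLt 1 2 21; Const 0 0; Halt]
  (* 22: pointers to blocks *)
  ++ rank_code ++ [:: JumpLt 10 11 30; Const 0 0; Halt]
  (* 30: choice of the row *)
  ++ row_address_code ++ [:: JumpLt 11 10 37] ++ swap_rows_code
  (* 37: the two bits *)
  ++ columns_code ++ [:: Halt].

Definition query_time : nat := 64.

Variables (w : nat) (M : nat -> nat).
Hypothesis w_gt1 : 1 < w.
Hypothesis M_lt : forall i, M i < 2 ^ w.

Local Arguments eval_binop : simpl never.
Local Arguments exec_regs w M R !i /.
Local Arguments upd f i v j /.

Definition computes (t c : nat) (R : nat -> nat) (v : nat) : Prop :=
  exists2 s, run w query_program t (State c R M) = Some s &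
    regs s 0 = v /\ Defs.mem s =1 M.

Lemma computes_halt t c R v :
  onth query_program c = Some Halt -> R 0 = v -> computes t c R v.
Proof. by move=> halt_c <-; exists (State c R M); rewrite ?run_halt. Qed.

Lemma computes_straight_line code t c R v :
    take (size code) (drop c query_program) = code -> all straight_line code ->
    size code <= t ->
  computes (t - size code) (c + size code) (exec_block w M code R) v ->
  computes t c R v.
Proof.
move=> code_at sl_code le_t [s run_s s_spec]; exists s => //.
by rewrite (run_straight_line _ _ _ code_at).
Qed.

Lemma computes_jump_eq t c R x y l v :
    onth query_program c = Some (JumpEq x y l) -> 0 < t ->
  computes t.-1 (if R x == R y then l else c.+1) R v -> computes t c R v.
Proof.
case: t => [//|t] jump_c _ [s run_s s_spec]; exists s => //.
by rewrite (run_jump_eq _ _ _ _ jump_c).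
Qed.

Lemma computes_jump_lt t c R x y l v :
    onth query_program c = Some (JumpLt x y l) -> 0 < t ->
  computes t.-1 (if R x < R y then l else c.+1) R v -> computes t c R v.
Proof.
case: t => [//|t] jump_c _ [s run_s s_spec]; exists s => //.
by rewrite (run_jump_lt _ _ _ _ jump_c).
Qed.

Let four_le : 4 <= 2 ^ w. Proof. by rewrite (@leq_exp2l 2 2). Qed.

Lemma computes_dispatch t R v : R 9 = 0 ->
    (forall R', [/\ R' 0 = R 0, R' 1 = R 1 & R' 2 = R 2] ->
      [/\ R' 3 = M 0, R' 4 = 1, R' 5 = 2, R' 6 = M 1 & R' 9 = 0] ->
      if M 0 < 2 then computes t.+1 15 R' v
      else computes t (if M 1 == 0 then 22 else 6) R' v) ->
  computes t.+2.+4 0 R v.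
Proof.
move=> R9 next; apply: (@computes_straight_line dispatch_code) => //.
set R' := exec_block _ _ _ _.
have R'_query : [/\ R' 0 = R 0, R' 1 = R 1 & R' 2 = R 2] by [].
have R'4 : R' 4 = 1 by apply: modn_small; lia.
have R'6 : R' 6 = M 1 := congr1 M R'4.
have R'3 : R' 3 = M 0 := congr1 M R9.
have R'5 : R' 5 = 2 by apply: modn_small; lia.
have {next} := next R' R'_query (And5 R'3 R'4 R'5 R'6 R9).
move=> next; apply: computes_jump_lt; [by []|by []|]; rewrite R'3 R'5.
case: ltnP next => _ //; rewrite -R'6 -[X in _ == X]R9 => next.
exact: computes_jump_eq.
Qed.

Lemma computes_matrix_bit R :
    R 9 = 0 -> M 0 = w -> 0 < M 1 -> R 2 < 2 ^ w ->
    R 1 * M 1 + 2 + R 2 %/ w < 2 ^ w ->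
  computes query_time 0 R (mem_bit w M (R 1 * M 1 + 2) (R 2)).
Proof.
move=> R9 M0 M1_gt0 lt_R2 lt_addr.
apply: computes_dispatch => // R' [_ R1 R2] [R3 _ R5 R6 _].
rewrite M0 ltnNge w_gt1 gtn_eqF //=.
apply: (@computes_straight_line matrix_code) => //; apply: computes_halt => //.
have lt_row := leq_ltn_trans (leq_addr _ _) lt_addr.
have lt_mul := leq_ltn_trans (leq_addr _ _) lt_row.
rewrite -eval_fetchE // -(@eval_add w) // -(@eval_mul w) //.
by rewrite /= R1 R2 R3 R5 R6 M0.
Qed.

Lemma computes_order_bit (b : bool) R :
    R 9 = 0 -> M 0 = b -> R 1 < 2 ^ w -> R 2 < 2 ^ w ->
  computes query_time 0 R
    (if (if b then R 2 < R 1 else R 1 < R 2) then R 0 else 0).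
Proof.
move=> R9 M0 lt_R1 lt_R2; apply: computes_dispatch => // R' [R0 R1 R2] [R3 _ _ _ R'9].
have -> : M 0 < 2 by rewrite M0; case: (b).
have test t (Q : nat -> nat) : Q 0 = R 0 ->
    computes t.+3 19 Q (if Q 1 < Q 2 then R 0 else 0).
  move=> Q0; apply: computes_jump_lt => //; case: ltnP => _; first exact: computes_halt.
  apply: (@computes_straight_line [:: Const 0 0]) => //; exact/computes_halt/mod0n.
apply: computes_jump_eq => //; rewrite R3 M0 R'9; case: b {M0} => /=; last first.
  by rewrite -R1 -R2; apply: test.
apply: (@computes_straight_line swap_code) => //; set Q := exec_block _ _ _ _.
have Q1 : Q 1 = R 2 by rewrite /Q /= R2 R'9 eval_add addn0.
have Q2 : Q 2 = R 1 by rewrite /Q /= R1 R'9 !eval_add ?addn0.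
by rewrite -Q1 -Q2; apply: test.
Qed.

Definition rank_field (x : nat) : nat := M (x * 4).
Definition row_field (x : nat) : nat := M (x * 4 + 1).
Definition flag_field (x : nat) : nat := M (x * 4 + 2).
Definition offset_field (x : nat) : nat := M (x * 4 + 3).

Definition pair_bit (x y : nat) : bool :=
  row_bit w M (M 2) (row_field x) (flag_field y) &&
  row_bit w M (M 2) (row_field x) (offset_field y).

Definition pair_addressable (x y : nat) : Prop :=
  row_addressable w M (M 2) (row_field x) (flag_field y) /\
  row_addressable w M (M 2) (row_field x) (offset_field y).

Lemma computes_columns t R x y :
    R 3 = w -> R 4 = 1 -> R 5 = 2 -> R 10 = row_field x -> R 2 = y * 4 + 1 ->
    y * 4 + 3 < 2 ^ w -> pair_addressable x y -> size columns_code <= t ->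
  computes t 37 R (pair_bit x y).
Proof.
move=> R3 R4 R5 R10 R2 lt_y [addr_flag addr_offset] le_t.
apply: (@computes_straight_line columns_code) => //; apply: computes_halt => //.
have eval_flag : eval_binop w OpAdd (R 2) 1 = y * 4 + 2.
  by rewrite R2 eval_add -addnA //; lia.
have eval_offset : eval_binop w OpAdd (y * 4 + 2) 1 = y * 4 + 3.
  by rewrite eval_add -addnA.
rewrite /= R3 R4 R5 R10 eval_flag eval_offset -/(flag_field _) -/(offset_field _).
rewrite -!/(eval_fetch _ _ _ _) -!/(eval_row_fetch _ _ _ _ _) !eval_row_fetchE //.
by rewrite eval_mul mulnb // (leq_trans _ four_le) // ltnS (leq_trans (leq_b1 _)).
Qed.

Lemma computes_pair_bit R :
    R 9 = 0 -> M 0 = w -> M 1 = 0 -> 4 < 2 ^ w ->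
    R 1 * 4 + 3 < 2 ^ w -> R 2 * 4 + 3 < 2 ^ w ->
    pair_addressable (R 1) (R 2) -> pair_addressable (R 2) (R 1) ->
  computes query_time 0 R
    ((rank_field (R 1) < rank_field (R 2)) &&
     if row_field (R 2) < row_field (R 1) then pair_bit (R 1) (R 2)
     else pair_bit (R 2) (R 1)).
Proof.
move=> R9 M0 M1 lt4 lt_R1 lt_R2 addr12 addr21.
apply: computes_dispatch => // R' [_ R'1 R'2] [R'3 R'4 R'5 _ R'9].
rewrite M0 M1 ltnNge w_gt1 /=.
apply: (@computes_straight_line rank_code) => //.
apply: computes_jump_lt => //=; rewrite R'1 R'2 (modn_small lt4) !eval_mul; try by lia.
rewrite -/(rank_field _) -/(rank_field _); case: ltnP => _; last first.
  by apply: (@computes_straight_line [:: Const 0 0]) => //; exact/computes_halt/mod0n.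
apply: (@computes_straight_line row_address_code) => //.
apply: computes_jump_lt => //=; rewrite R'4 !eval_add; try by lia.
rewrite -/(row_field _) -/(row_field _); case: ltnP => _ /=.
  by apply: computes_columns => //=; rewrite ?R'3.
apply: (@computes_straight_line swap_rows_code) => //.
by apply: computes_columns => //=; rewrite ?R'3 // R'9 eval_add addn0 ?M_lt //; lia.
Qed.

End QueryProgram.

(** * Bicliques *)

Section Bicliques.
Local Open Scope nat_scope.
Variables (T : finType) (adj : rel T) (q : nat).
Implicit Types (A B R X Y : {set T}) (u x : T).

Definition nbhd (u : T) : {set T} := [set x | adj u x].

Definition biclique (A B : {set T}) : bool :=
  [&& #|A| == q, #|B| == q & [forall a in A, B \subset nbhd a]].

Definition biclique_free (R : {set T}) : Prop :=
  forall A B : {set T}, A \subset R -> B \subset R -> ~~ biclique A B.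

Lemma bicliqueP A B :
  reflect [/\ #|A| = q, #|B| = q & {in A & B, forall a b, adj a b}] (biclique A B).
Proof.
apply: (iffP and3P) => [[/eqP cA /eqP cB /forall_inP subN]|[-> -> adjAB]]; split=> //.
  by move=> a b /subN/subsetP sub_aB /sub_aB; rewrite inE.
by apply/forall_inP => a aA; apply/subsetP => b bB; rewrite inE adjAB.
Qed.

Lemma subset_of_card m A : m <= #|A| -> exists2 B : {set T}, B \subset A & #|B| = m.
Proof.
case/card_geqP=> s [uniq_s <- sub_sA]; exists [set x in s].
  by apply/subsetP => x; rewrite inE => /sub_sA.
by rewrite cardsE (card_uniqP uniq_s).
Qed.

Lemma card_common_neighbours R A : biclique_free R -> A \subset R -> #|A| = q ->
  #|[set u in R | A \subset nbhd u]| < q.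
Proof.
move=> free_R sub_AR card_A; rewrite ltnNge; apply/negP.
case/subset_of_card=> B sub_B card_B.
have /negP[] : ~~ biclique B A.
  apply: free_R => //; apply: subset_trans sub_B _.
  by apply/subsetP => u; rewrite inE => /andP[].
rewrite /biclique card_A card_B !eqxx; apply/forall_inP => u /(subsetP sub_B).
by rewrite inE => /andP[].
Qed.

(* Double counting of the pairs (u, A) where A is a q-subset of X and of nbhd u. *)
Lemma card_many_neighbours R X : biclique_free R -> X \subset R ->
  #|[set u in R | q <= #|X :&: nbhd u|]| <= 'C(#|X|, q) * q.
Proof.
move=> free_R sub_XR; pose D := [set A : {set T} | A \subset X & #|A| == q].
rewrite -cards_draws -/D -sum_nat_const.
apply: (@leq_trans (\sum_(u in R) \sum_(A in D | A \subset nbhd u) 1)); last first.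
  rewrite (exchange_big_dep (mem D)) //=; last by move=> u A _ /andP[].
  apply: leq_sum => A D_A.
  have /andP[sub_AX /eqP card_A] : (A \subset X) && (#|A| == q) by rewrite inE in D_A.
  rewrite (eq_bigl (mem [set u in R | A \subset nbhd u])) => [|u].
    by rewrite sum1_card ltnW // card_common_neighbours // (subset_trans sub_AX).
  by rewrite [RHS]in_set D_A.
rewrite -sum1_card [leqRHS](bigID [pred u | q <= #|X :&: nbhd u|]) /=.
apply: leq_trans (leq_addr _ _); rewrite (eq_bigl _ _ (fun u => in_set _ u)).
apply: leq_sum => u /andP[_ many_u].
have /card_gt0P[A] : 0 < #|[set A : {set T} | A \subset X :&: nbhd u & #|A| == q]|.
  by rewrite cards_draws bin_gt0.
rewrite inE subsetI -andbA => /and3P[sub_AX sub_Au card_A].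
by rewrite (bigD1 A) // inE sub_AX sub_Au card_A.
Qed.

Lemma leq_bin_expn n k : 'C(n, k) <= n ^ k.
Proof.
apply: leq_trans (leq_pmulr _ (fact_gt0 k)) _; rewrite bin_ffact ffact_prod.
by rewrite -[in n ^ k](card_ord k) -prod_nat_const leq_prod // => i _; apply: leq_subr.
Qed.

Lemma sum_degree_chunk_leq s R X : biclique_free R -> X \subset R -> #|X| <= s ->
  \sum_(u in R) #|X :&: nbhd u| <= #|R| * q + s ^ q * q * s.
Proof.
move=> free_R sub_XR card_X; pose many u := q <= #|X :&: nbhd u|.
apply: (@leq_trans (\sum_(u in R) (q + many u * s))).
  apply: leq_sum => u _; rewrite /many.
  case: (leqP q) => [_|/ltnW]; last by rewrite addn0.
  rewrite mul1n (leq_trans _ (leq_addl _ _)) // (leq_trans _ card_X) //.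
  by rewrite subset_leq_card ?subsetIl.
rewrite big_split /= sum_nat_const -big_distrl leq_add2l leq_mul2r; apply/orP; right.
have -> : \sum_(u in R) many u = #|[set u in R | many u]|.
  by rewrite -sum1dep_card big_mkcondr.
apply: leq_trans (card_many_neighbours free_R sub_XR) _.
rewrite leq_mul2r; apply/orP; right.
exact: leq_trans (leq_bin2l q card_X) (leq_bin_expn s q).
Qed.

Lemma sum_degree_leq s R Y : 0 < s -> biclique_free R -> Y \subset R ->
  \sum_(u in R) #|Y :&: nbhd u| <= (#|Y| %/ s).+1 * (#|R| * q + s ^ q * q * s).
Proof.
move=> s_gt0 free_R; have [m] := ubnP #|Y|; elim: m Y => // m IHm Y lt_Ym sub_YR.
have [le_Ys|lt_sY] := leqP #|Y| s.
  by apply: leq_trans (sum_degree_chunk_leq free_R sub_YR le_Ys) _; apply: leq_pmull.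
have [X sub_XY card_X] := subset_of_card (ltnW lt_sY).
have card_YX : #|Y :\: X| = #|Y| - s by rewrite cardsD (setIidPr sub_XY) card_X.
have -> : \sum_(u in R) #|Y :&: nbhd u|
    = \sum_(u in R) #|X :&: nbhd u| + \sum_(u in R) #|(Y :\: X) :&: nbhd u|.
  rewrite -big_split; apply: eq_bigr => u _.
  by rewrite -(cardsID X (Y :&: nbhd u)) setIAC (setIidPr sub_XY) setIDAC.
have -> : (#|Y| %/ s).+1 = 1 + (#|Y :\: X| %/ s).+1.
  by rewrite card_YX -{1}(subnK (ltnW lt_sY)) divnDr ?divnn ?s_gt0 ?addn1.
rewrite mulnDl mul1n leq_add //.
  by rewrite sum_degree_chunk_leq ?card_X // (subset_trans sub_XY).
by rewrite IHm ?card_YX ?(subset_trans (subsetDl _ _)) //; lia.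
Qed.

Definition induced_edges (R : {set T}) : {set T * T} :=
  [set uv | [&& uv.1 \in R, uv.2 \in R & adj uv.1 uv.2]].

Definition degree_sum_bound (n s : nat) : nat := (n %/ s).+1 * (n * q + s ^ q * q * s).

Lemma card_induced_edges_leq s R : 0 < s -> biclique_free R ->
  #|induced_edges R| <= degree_sum_bound #|T| s.
Proof.
move=> s_gt0 free_R; have -> : #|induced_edges R| = \sum_(u in R) #|R :&: nbhd u|.
  under eq_bigr => u _ do rewrite -sum1_card.
  by rewrite -sum1_card pair_big_dep; apply: eq_bigl => -[u v]; rewrite !inE.
apply: leq_trans (sum_degree_leq s_gt0 free_R (subxx R)) _.
by rewrite leq_mul // ?ltnS ?leq_div2r ?leq_add2r ?leq_mul2r ?max_card ?orbT.
Qed.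

Hypotheses (adj_irr : irreflexive adj) (q_gt0 : 0 < q).
Variable x0 : T.

Definition biclique_list (K : nat) (s : seq T) : Prop :=
  [/\ uniq s, size s = 2 * q * K
    & forall k i j, k < K -> i < q -> j < q ->
        adj (nth x0 s (2 * q * k + i)) (nth x0 s (2 * q * k + q + j))].

Lemma biclique_list_cat K s A B : biclique_list K s ->
    A \subset [set x | x \notin s] -> B \subset [set x | x \notin s] -> biclique A B ->
  biclique_list K.+1 (s ++ enum A ++ enum B).
Proof.
move=> [uniq_s size_s adj_s] /subsetP new_A /subsetP new_B.
case/bicliqueP=> card_A card_B adj_AB.
have [size_A size_B] : size (enum A) = q /\ size (enum B) = q by rewrite -!cardE.
split.
- rewrite !cat_uniq uniq_s !enum_uniq andbT has_cat /=; apply/andP; split.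
    rewrite negb_or; apply/andP; split; apply/hasPn => x; rewrite mem_enum.
      by move/new_A; rewrite inE.
    by move/new_B; rewrite inE.
  apply/hasPn => x; rewrite !mem_enum => xB; apply/negP => xA.
  by have := adj_AB x x xA xB; rewrite adj_irr.
- by rewrite !size_cat size_A size_B size_s mulnSr; lia.
move=> k i j; rewrite ltnS leq_eqVlt => /predU1P[->|lt_kK] lt_iq lt_jq; last first.
  have : 2 * q * k.+1 <= 2 * q * K by rewrite leq_mul2l lt_kK orbT.
  rewrite mulnS !nth_cat size_s => le_kK.
  by rewrite !ifT; first exact: adj_s; lia.
rewrite -size_s -addnA !nth_cat_addn nth_cat size_A lt_iq -size_A nth_cat_addn.
by apply: adj_AB; rewrite -mem_enum mem_nth ?size_A ?size_B.
Qed.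

Lemma maximal_biclique_list : exists K s,
  biclique_list K s /\ biclique_free [set x | x \notin s].
Proof.
have [m] := ubnP (#|T| - @size T [::]).
have : biclique_list 0 [::] by split; rewrite ?muln0.
elim: m 0 [::] => // m IHm K s list_s lt_m.
have [/existsP[A /existsP[B /and3P[sub_A sub_B bic_AB]]]|none] :=
  boolP [exists A : {set T}, exists B : {set T},
    [&& A \subset [set x | x \notin s], B \subset [set x | x \notin s] & biclique A B]].
  have list_s' := biclique_list_cat list_s sub_A sub_B bic_AB; apply: (IHm _ _ list_s').
  case: list_s list_s' => _ size_s _ [uniq_s' size_s' _].
  have := max_card (mem (s ++ enum A ++ enum B)); rewrite (card_uniqP uniq_s').
  by move: lt_m; rewrite size_s' size_s mulnS; lia.
exists K, s; split=> // A B sub_A sub_B; apply: contra none => bic_AB.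
by apply/existsP; exists A; apply/existsP; exists B; rewrite sub_A sub_B.
Qed.

End Bicliques.

(** * Row codes *)

Section GroupedRows.
Local Open Scope nat_scope.
Variables (g : rel nat) (n q K : nat).
Hypothesis g_lt : forall i j, g i j -> i < n.
Hypothesis g_triangle : forall i j k, g i j -> g j k -> ~~ g i k.
Hypothesis g_biclique : forall k i j, k < K -> i < q -> j < q ->
  g (2 * q * k + i) (2 * q * k + q + j).
Hypotheses (q_gt1 : 1 < q) (le_groups : 2 * q * K <= n).

Definition meets_side (p c : nat) : bool := [exists i : 'I_q, g p (c + i)].

(* A vertex has no neighbours on both sides of a biclique: two flags tell the side,
   and q bits the offsets of the neighbours within that side. *)
Definition group_bit (p k r : nat) : bool :=
  match r with
  | 0 => meets_side p (2 * q * k)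
  | 1 => meets_side p (2 * q * k + q)
  | i.+2 => g p (2 * q * k + i) || g p (2 * q * k + q + i)
  end.

(* Row p starts with the groups up to that of p only, as each pair is looked up in
   the row of its larger end. *)
Definition stored_bit (p o : nat) : bool :=
  if o < K * (q + 2) then
    (o %/ (q + 2) <= p %/ (2 * q)) && group_bit p (o %/ (q + 2)) (o %% (q + 2))
  else
    let j := o - K * (q + 2) in [&& 2 * q * K <= p, 2 * q * K <= j & g p j].

Definition flag_col (j : nat) : nat :=
  if j < 2 * q * K then j %/ (2 * q) * (q + 2) + j %% (2 * q) %/ q
  else K * (q + 2) + j.

Definition offset_col (j : nat) : nat :=
  if j < 2 * q * K then j %/ (2 * q) * (q + 2) + (j %% q).+2
  else K * (q + 2) + j.

Lemma meets_sideP p c : reflect (exists2 i, i < q & g p (c + i)) (meets_side p c).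
Proof.
apply: (iffP existsP) => [[i gpi]|[i lt_iq gpi]]; first by exists i.
by exists (Ordinal lt_iq).
Qed.

Lemma group_bitE p k (side : bool) i : k < K -> i < q ->
  g p (2 * q * k + side * q + i) = group_bit p k side && group_bit p k i.+2.
Proof.
move=> lt_kK lt_iq; apply/idP/andP => [gpi|].
  split; last by case: side gpi => /=; rewrite ?mul1n ?addn0 => ->; rewrite ?orbT.
  by case: side gpi => /=; rewrite ?mul1n ?addn0 => gpi; apply/meets_sideP; exists i.
case: side => /= -[/meets_sideP[j lt_jq gpj] /orP[] gpi]; rewrite ?mul1n ?addn0 //.
  by have := g_triangle gpi (g_biclique lt_kK lt_iq lt_jq); rewrite gpj.
by have := g_triangle gpj (g_biclique lt_kK lt_jq lt_iq); rewrite gpi.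
Qed.

Lemma stored_bit_group p k r : k < K -> r < q + 2 ->
  stored_bit p (k * (q + 2) + r) = (k <= p %/ (2 * q)) && group_bit p k r.
Proof.
by move=> lt_kK lt_r; rewrite /stored_bit ltn_rowmajor // divn_rowmajor ?modn_rowmajor.
Qed.

Lemma stored_bit_tail p j : 2 * q * K <= p -> 2 * q * K <= j ->
  stored_bit p (K * (q + 2) + j) = g p j.
Proof. by move=> le_p le_j; rewrite /stored_bit ltnNge leq_addr addKn le_p le_j. Qed.

Let q2_gt0 : 0 < 2 * q. Proof. by rewrite muln_gt0 (ltnW q_gt1). Qed.

Let group_lt j : j < 2 * q * K -> j %/ (2 * q) < K.
Proof. by rewrite ltn_divLR // mulnC. Qed.

Let side_lt j : j %% (2 * q) %/ q < 2.
Proof. by rewrite ltn_divLR ?(ltnW q_gt1) // ltn_mod q2_gt0. Qed.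

Let side_lt_width j : j %% (2 * q) %/ q < q + 2.
Proof. by rewrite (leq_trans (side_lt j)) // addn2. Qed.

Let offset_lt_width j : (j %% q).+2 < q + 2.
Proof. by rewrite addn2 !ltnS ltn_mod ltnW. Qed.

Lemma stored_bitE p j : j <= p ->
  g p j = stored_bit p (flag_col j) && stored_bit p (offset_col j).
Proof.
move=> le_jp; rewrite /flag_col /offset_col; case: ltnP => [lt_j|le_j]; last first.
  by rewrite stored_bit_tail ?andbb // (leq_trans le_j).
rewrite !stored_bit_group ?group_lt ?side_lt_width ?offset_lt_width // leq_div2r //=.
have [side def_side] : exists side : bool, j %% (2 * q) %/ q = side.
  by case: (_ %/ q) (side_lt j) => [|[|]] //; [exists false | exists true].
rewrite def_side -group_bitE ?group_lt //; last by rewrite ltn_mod ltnW.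
congr (g p _).
rewrite -def_side {1}(divn_eq j (2 * q)) {1}(divn_eq (j %% (2 * q)) q).
by rewrite modn_dvdm ?dvdn_mull // mulnC addnA.
Qed.

Lemma col_lt j : j < n -> flag_col j < 2 * n /\ offset_col j < 2 * n.
Proof.
have le_code : K * (q + 2) <= n.
  by apply: leq_trans le_groups; rewrite [leqRHS]mulnC leq_mul2l; apply/orP; right; lia.
move=> lt_jn; rewrite /flag_col /offset_col.
case: (ltnP j) => [lt_j|_]; last by split; lia.
have in_code r : r < q + 2 -> j %/ (2 * q) * (q + 2) + r < 2 * n.
  by move/(ltn_rowmajor (group_lt lt_j)) => lt_r; apply: leq_trans lt_r _; lia.
by rewrite !in_code ?side_lt_width ?offset_lt_width.
Qed.

Lemma stored_bit_lt p o : stored_bit p o -> p < n.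
Proof.
rewrite /stored_bit; case: ifP => _; last by case/and3P=> _ _ /g_lt.
case/andP=> _; case: (o %% _) => [|[|i]] /=; try by case/meets_sideP=> i _ /g_lt.
by case/orP=> /g_lt.
Qed.

Variables (L : nat) (tail_edges : seq (nat * nat)).
Hypothesis tail_edgesP : forall i j,
  2 * q * K <= i -> 2 * q * K <= j -> g i j -> (i, j) \in tail_edges.

Definition dense_width (p : nat) : nat := (p %/ (2 * q)).+1 * (q + 2).

Definition stored_blocks : seq (nat * nat) :=
  [seq (p, b) | p <- iota 0 n, b <- iota 0 (dense_width p %/ L).+1] ++
  [seq (ij.1, (K * (q + 2) + ij.2) %/ L) | ij <- tail_edges].

Lemma mem_stored_blocks p o : stored_bit p o -> (p, o %/ L) \in stored_blocks.
Proof.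
move=> bit_po; have lt_pn := stored_bit_lt bit_po.
move: bit_po; rewrite /stored_bit mem_cat; case: ltnP => [_ /andP[le_group _]|le_o].
  apply/orP; left; apply/allpairsPdep; exists p, (o %/ L); split; rewrite ?mem_iota //=.
  by rewrite ltnS leq_div2r // ltnW // /dense_width -ltn_divLR ?addn2 // -addn2.
case/and3P=> le_p le_j g_pj; apply/orP; right; apply/mapP.
exists (p, o - K * (q + 2)); first exact: tail_edgesP.
by rewrite /= subnKC.
Qed.

Lemma size_stored_blocks :
  size stored_blocks = \sum_(p < n) (dense_width p %/ L).+1 + size tail_edges.
Proof.
rewrite size_cat size_allpairs_dep size_map sumnE big_map.
rewrite -(big_mkord xpredT (fun p => (dense_width p %/ L).+1)) /index_iota subn0.
by under eq_bigr do rewrite size_iota.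
Qed.

End GroupedRows.

Section TriangleFree.
Local Open Scope nat_scope.
Variables (T : finType) (adj : rel T).

Record row_code : Type := RowCode {
  row_index : T -> nat;
  flag_column : T -> nat;
  offset_column : T -> nat;
  code_bit : nat -> nat -> bool;
  row_index_lt : forall a, row_index a < #|T|;
  column_lt : forall a, flag_column a < 2 * #|T| /\ offset_column a < 2 * #|T|;
  code_bit_lt : forall p o, code_bit p o -> p < #|T|;
  code_bitE : forall a b, row_index b <= row_index a ->
    adj a b = code_bit (row_index a) (flag_column b) &&
              code_bit (row_index a) (offset_column b)
}.

Definition covers (c : row_code) (L : nat) (blocks : seq (nat * nat)) : Prop :=
  forall p o, code_bit c p o -> (p, o %/ L) \in blocks.

Definition block_count_bound (n q L s : nat) : nat :=
  \sum_(p < n) (dense_width q p %/ L).+1 + degree_sum_bound q n s.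

Section VertexOrder.
Variables (q K : nat) (x0 : T) (t : seq T).
Hypothesis list_t : biclique_list adj q x0 K t.

Definition vertex_order : seq T := t ++ enum [set x | x \notin t].
Local Notation u := vertex_order.

Lemma uniq_vertex_order : uniq u.
Proof.
have [uniq_t _ _] := list_t; rewrite cat_uniq uniq_t enum_uniq andbT.
by apply/hasPn => x; rewrite mem_enum inE.
Qed.

Lemma mem_vertex_order x : x \in u.
Proof. by rewrite mem_cat mem_enum inE orbN. Qed.

Lemma size_vertex_order : size u = #|T|.
Proof.
rewrite -(card_uniqP uniq_vertex_order).
by apply: eq_card => x; rewrite mem_vertex_order.
Qed.

Lemma index_vertex_order_lt a : index a u < #|T|.
Proof. by rewrite -size_vertex_order index_mem mem_vertex_order. Qed.

Lemma leq_groups : 2 * q * K <= #|T|.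
Proof. by have [_ <- _] := list_t; rewrite -size_vertex_order size_cat leq_addr. Qed.

Definition adj_at (i j : nat) : bool :=
  [&& i < #|T|, j < #|T| & adj (nth x0 u i) (nth x0 u j)].

Lemma adj_at_lt i j : adj_at i j -> i < #|T|. Proof. by case/and3P. Qed.

Lemma adj_at_index a b : adj_at (index a u) (index b u) = adj a b.
Proof. by rewrite /adj_at !index_vertex_order_lt !nth_index ?mem_vertex_order. Qed.

Lemma adj_at_biclique k i j : k < K -> i < q -> j < q ->
  adj_at (2 * q * k + i) (2 * q * k + q + j).
Proof.
have [_ size_t bic_t] := list_t; move=> lt_kK lt_iq lt_jq.
have le_k : 2 * q * k + 2 * q <= 2 * q * K by rewrite -mulnSr leq_mul2l lt_kK orbT.
have le_KT := leq_groups; apply/and3P; split; try by lia.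
by rewrite !nth_cat size_t !ifT; [apply: bic_t | lia | lia].
Qed.

Definition tail_edges : seq (nat * nat) :=
  [seq (index ab.1 u, index ab.2 u)
  | ab <- enum (induced_edges adj [set x | x \notin t])].

Lemma mem_tail_edges i j : 2 * q * K <= i -> 2 * q * K <= j -> adj_at i j ->
  (i, j) \in tail_edges.
Proof.
have [_ size_t _] := list_t.
move=> le_i le_j /and3P[lt_i lt_j adj_ij]; apply/mapP; exists (nth x0 u i, nth x0 u j).
  have in_tail k : 2 * q * K <= k -> k < #|T| -> nth x0 u k \in [set x | x \notin t].
    rewrite -size_vertex_order size_cat -size_t => le_k lt_k.
    by rewrite nth_cat ltnNge le_k -mem_enum mem_nth ?ltn_subLR.
  by rewrite mem_enum in_set /= adj_ij !in_tail.
by rewrite /= !index_uniq ?size_vertex_order ?uniq_vertex_order.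
Qed.

End VertexOrder.

Hypothesis adj_irr : irreflexive adj.
Hypothesis adj_triangle : forall a b c, adj a b -> adj b c -> ~~ adj a c.
Hypothesis T_gt0 : 0 < #|T|.

Lemma adj_at_triangle x0 t i j k :
  adj_at x0 t i j -> adj_at x0 t j k -> ~~ adj_at x0 t i k.
Proof.
move=> /and3P[_ _ adj_ij] /and3P[_ _ adj_jk]; apply/and3P => -[_ _].
exact/negP/(adj_triangle adj_ij).
Qed.

Lemma triangle_free_row_code q L s : 1 < q -> 0 < s ->
  exists (c : row_code) (blocks : seq (nat * nat)),
    covers c L blocks /\ size blocks <= block_count_bound #|T| q L s.
Proof.
move=> q_gt1 s_gt0; have /card_gt0P[x0 _] := T_gt0.
have [K [t [list_t free_t]]] := maximal_biclique_list adj_irr (ltnW q_gt1) x0.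
pose idx a := index a (vertex_order t); pose bits := stored_bit (adj_at x0 t) q K.
have idx_lt a : idx a < #|T| := index_vertex_order_lt list_t a.
have column_lt a := col_lt q_gt1 (leq_groups list_t) (idx_lt a).
have bits_lt p o : bits p o -> p < #|T| := stored_bit_lt (@adj_at_lt x0 t) (o := o).
have bitsE a b : idx b <= idx a ->
    adj a b = bits (idx a) (flag_col q K (idx b)) &&
              bits (idx a) (offset_col q K (idx b)).
  move/(stored_bitE (@adj_at_triangle x0 t) (adj_at_biclique list_t) q_gt1) <-.
  by rewrite (adj_at_index list_t).
exists (RowCode idx_lt column_lt bits_lt bitsE).
exists (stored_blocks #|T| q K L (tail_edges t)); split.
  by move=> p o; apply: mem_stored_blocks; [exact: adj_at_lt | exact: mem_tail_edges].
by rewrite size_stored_blocks size_map -cardE leq_add2l card_induced_edges_leq.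
Qed.

End TriangleFree.

(** * Memory images *)

Section MemoryImages.
Local Open Scope nat_scope.

Definition matrix_size (n w : nat) : nat := 2 + n.+1 * (n %/ w).+1.

(* In words: a header and label records, pointers, and blocks of l words each. *)
Definition compressed_size (n w l blocks : nat) : nat :=
  4 * n.+1 + n * (2 * n %/ (l * w)).+1 + blocks.+1 * l.

Variables (T : finType) (lab : T -> nat) (w : nat).
Hypotheses (labP : labelling #|T| lab) (w_gt1 : 1 < w).
Local Notation n := #|T|.

Definition encodable (r : rel T) (m : nat) : Prop :=
  exists2 B : seq bool, size B <= m &
    forall a b, answers w query_program query_time B (lab a) (lab b) (r a b).

Let w_gt0 : 0 < w := ltnW w_gt1.

Let lab_gt0 a : 0 < lab a. Proof. by case: labP => _ /(_ a)/andP[]. Qed.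

Let lab_le a : lab a <= n. Proof. by case: labP => _ /(_ a)/andP[]. Qed.

Lemma answers_of_computes B a b (v : bool) : n < 2 ^ w ->
    (forall R, [/\ R 0 = size B %% 2 ^ w, R 1 = lab a, R 2 = lab b & R 9 = 0] ->
       computes w (pack w B) query_time 0 R v) ->
  answers w query_program query_time B (lab a) (lab b) v.
Proof.
move=> lt_n computes_v; apply: (computes_v (regs (query_state w B (lab a) (lab b)))).
by split; rewrite //= modn_small // (leq_ltn_trans (lab_le _)).
Qed.

Definition unlabel (x : nat) : option T := [pick a | lab a == x].

Lemma unlabelK : pcancel lab unlabel.
Proof.
case: labP => lab_inj _ a; rewrite /unlabel; case: pickP => [b /eqP/lab_inj->//|].
by move/(_ a); rewrite eqxx.
Qed.

Section TwoElements.
Variable r : rel T.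
Hypothesis r_asym : forall a b, r a b -> ~~ r b a.

Lemma asymmetric_two_elementsE (s : rel T) a b : n = 2 ->
    (forall x y, s x y -> ~~ s y x) -> s a b ->
  forall x y, s x y = (x == a) && (y == b).
Proof.
move=> card_T s_asym s_ab x y; have s_irr z : s z z = false.
  by apply/negP => szz; have := s_asym z z szz; rewrite szz.
have ne_ab : a != b by apply: contraTneq s_ab => ->; rewrite s_irr.
have ab_full z : (z == a) || (z == b).
  have /setP/(_ z) : [set a; b] = [set: T].
    by apply/eqP; rewrite eqEcard subsetT cardsT card_T cards2 ne_ab.
  by rewrite !inE.
apply/idP/andP => [|[/eqP-> /eqP->] //].
have [/orP[]/eqP-> /orP[]/eqP->] := (ab_full x, ab_full y) => //; rewrite ?s_irr //.
by rewrite (negbTE (s_asym _ _ s_ab)).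
Qed.

Lemma pack_head B : size B <= 1 -> pack w B 0 = nth false B 0.
Proof.
move=> size_B; have -> : pack w B 0 = word_of_bits w (nth false B) by [].
rewrite -(prednK w_gt0) word_of_bitsS /word_of_bits big1 ?addn0 // => i _.
by rewrite nth_default ?(leq_trans size_B).
Qed.

Definition label_order (flip : bool) : rel T :=
  fun a b => if flip then lab b < lab a else lab a < lab b.

Lemma label_order_asym flip a b : label_order flip a b -> ~~ label_order flip b a.
Proof. by rewrite /label_order; case: flip => lt_ab; rewrite -leqNgt ltnW. Qed.

Lemma label_order_encodable B : n = 2 -> size B <= 1 ->
    (forall a b, r a b = (size B == 1) && label_order (nth false B 0) a b) ->
  encodable r 1.
Proof.
move=> card_T size_B rE; exists B => // a b.
have four_le : 4 <= 2 ^ w by rewrite (@leq_exp2l 2 2).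
have lt_lab x : lab x < 2 ^ w by rewrite (leq_ltn_trans (lab_le x)) // card_T; lia.
apply: answers_of_computes => [|R [R0 R1 R2 R9]]; first by rewrite card_T; lia.
have := computes_order_bit w_gt1 (M := pack w B) (b := nth false B 0) R9.
rewrite pack_head // R1 R2 R0 modn_small ?rE; last by lia.
move/(_ erefl (lt_lab a) (lt_lab b)); rewrite -/(label_order _ a b).
by case: B size_B {rE R0} => [|flip []] // _; case: label_order.
Qed.

(* As lg (lg 2) = 0, only one bit is available for the three posets on two
   elements; the empty bit string has to serve as the third code. *)
Lemma two_element_encodable : n = 2 -> encodable r 1.
Proof.
move=> card_T; case: (boolP [exists a, exists b, r a b]) => [|none]; last first.
  apply: (label_order_encodable (B := [::])) => // a b; apply: contraNF none => r_ab.
  by apply/existsP; exists a; apply/existsP; exists b.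
case/existsP=> a /existsP[b r_ab]; have order_ab : label_order (lab b < lab a) a b.
  rewrite /label_order; case: ltngtP => // /(pcan_inj unlabelK) eq_ab.
  by have := r_asym r_ab; rewrite eq_ab in r_ab *; rewrite r_ab.
apply: (label_order_encodable (B := [:: lab b < lab a])) => // x y.
rewrite (asymmetric_two_elementsE card_T r_asym r_ab) /=.
by rewrite (asymmetric_two_elementsE card_T (@label_order_asym _) order_ab).
Qed.

End TwoElements.

Section BitMatrix.
Variable r : rel T.
Let W := (n %/ w).+1.

Definition matrix_bit (x y : nat) : bool :=
  if (unlabel x, unlabel y) is (Some a, Some b) then r a b else false.

Definition matrix_words : seq nat :=
  [:: w; W] ++ table n.+1 W (fun x => row_word w (matrix_bit x)).

Lemma matrix_encodable : matrix_size n w <= 2 ^ w -> encodable r (matrix_size n w * w).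
Proof.
rewrite /matrix_size -/W => fits; have lt_w : w < 2 ^ w by apply: ltn_expl.
have lt_n : n < 2 ^ w.
  by apply: leq_trans fits; rewrite (leq_trans _ (leq_addl _ _)) ?leq_pmulr.
have packE : pack w (bits_of_words w matrix_words) =1 nth 0 matrix_words.
  apply: pack_bits_of_words; rewrite all_cat all_table => [|x y _ _].
    by rewrite /= lt_w !andbT (leq_trans _ fits) // addnC addn2 ltnS leqW ?leq_pmull.
  exact: ltn_word_of_bits.
exists (bits_of_words w matrix_words) => [|a b].
  by rewrite size_bits_of_words size_cat size_table.
have lt_q : lab b %/ w < W by rewrite ltnS leq_div2r.
have lt_addr : lab a * W + lab b %/ w < n.+1 * W by rewrite ltn_rowmajor // ltnS.
apply: answers_of_computes => // R [_ R1 R2 R9].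
have := computes_matrix_bit w_gt1 (@ltn_pack w (bits_of_words w matrix_words)) R9.
rewrite R1 R2 /mem_bit !packE /= addnAC [_ + 2]addnC (nth_cat_addn 0 [:: w; W]).
rewrite nth_table ?(leq_ltn_trans (lab_le a)) // bit_row_word //.
rewrite /matrix_bit !unlabelK; apply=> //.
  exact: leq_ltn_trans (lab_le b) lt_n.
by rewrite (leq_trans _ fits) // ltn_add2l.
Qed.

End BitMatrix.

Section Compressed.
Variables (l : nat) (rank : T -> nat) (adj : rel T) (c : row_code adj).
Variable blocks : seq (nat * nat).
Let L := l * w.
Let W := (2 * n %/ L).+1.
Let words := compressed_size n w l (size blocks).

Definition label_record (a : T) : seq nat :=
  [:: rank a; 4 * n.+1 + row_index c a * W; flag_column c a; offset_column c a].

Definition label_word (x f : nat) : nat :=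
  if unlabel x.+1 is Some a then nth 0 (label_record a) f else 0.

Definition pointer_word (p b : nat) : nat :=
  4 * n.+1 + n * W + index (p, b) blocks * l.

(* Row n is empty, so it serves as the default: a block missing from the list has
   index size blocks and is thus read as zeros. *)
Definition block_word (t : nat) : nat -> nat :=
  let: (p, b) := nth (n, 0) blocks t in row_word w (fun o => code_bit c p (b * L + o)).

Definition compressed_words : seq nat :=
  ([:: w; 0; L; 0] ++ table n 4 label_word) ++ table n W pointer_word
  ++ table (size blocks).+1 l block_word.

Let size_label_words : size ([:: w; 0; L; 0] ++ table n 4 label_word) = 4 * n.+1.
Proof. by rewrite size_cat size_table [RHS]mulnS [4 * n]mulnC. Qed.

Lemma size_compressed_words : size compressed_words = words.
Proof. by rewrite size_cat size_label_words size_cat !size_table addnA. Qed.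

Lemma nth_label_word a f : f < 4 ->
  nth 0 compressed_words (lab a * 4 + f) = nth 0 (label_record a) f.
Proof.
move=> lt_f4; have lt_a : (lab a).-1 < n by rewrite prednK.
rewrite -{1}(prednK (lab_gt0 a)) mulSn -addnA /compressed_words -catA.
rewrite (nth_cat_addn 0 [:: w; 0; L; 0]) nth_cat size_table ltn_rowmajor //.
by rewrite nth_table // /label_word prednK // unlabelK.
Qed.

Lemma nth_pointer_word p b : p < n -> b < W ->
  nth 0 compressed_words (4 * n.+1 + p * W + b) = pointer_word p b.
Proof.
move=> lt_pn lt_bW; rewrite -size_label_words -addnA nth_cat_addn.
by rewrite nth_cat size_table ltn_rowmajor // nth_table.
Qed.

Lemma nth_block_word t i : t <= size blocks -> i < l ->
  nth 0 compressed_words (4 * n.+1 + n * W + t * l + i) = block_word t i.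
Proof.
move=> le_t lt_il; rewrite -size_label_words -!addnA nth_cat_addn.
by rewrite -(size_table n W pointer_word) nth_cat_addn nth_table.
Qed.

Hypotheses (l_gt0 : 0 < l) (fits : words <= 2 ^ w) (fits_L : L < 2 ^ w).
Hypothesis c_blocks : covers c L blocks.
Hypothesis rank_le : forall a, rank a <= n.

Let memory := pack w (bits_of_words w compressed_words).

Let labels_fit : 4 * n.+1 < 2 ^ w.
Proof.
apply: leq_trans fits; rewrite /words /compressed_size -addnA -addn1 leq_add2l.
by rewrite (leq_trans _ (leq_addl _ _)) // muln_gt0.
Qed.

Lemma ltn_compressed_words : all (ltn^~ (2 ^ w)) compressed_words.
Proof.
have lt_w : w < 2 ^ w by apply: ltn_expl.
have exp_gt0 : 0 < 2 ^ w by rewrite expn_gt0.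
rewrite !all_cat !all_table /= ?lt_w ?fits_L ?exp_gt0 //.
- move=> t i _ _; rewrite /block_word; case: nth => p b; exact: ltn_word_of_bits.
- move=> p b _ _; apply: leq_trans fits.
  by rewrite /words /compressed_size ltn_add2l ltn_mul2r l_gt0 ltnS index_size.
move=> x f _ _; rewrite /label_word; case: unlabel => [a|//].
have [lt_flag lt_offset] := column_lt c a; have le_rank := rank_le a.
have lt_row : 4 * n.+1 + row_index c a * W < 2 ^ w.
  apply: leq_trans fits; rewrite /words /compressed_size -addnA ltn_add2l ltn_addr //.
  by rewrite ltn_mul2r row_index_lt.
by move: f => [|[|[|[|f]]]] //=; rewrite ?nth_nil //; lia.
Qed.

Let memoryE : memory =1 nth 0 compressed_words.
Proof. exact/pack_bits_of_words/ltn_compressed_words. Qed.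

Lemma row_bit_compressed p o : p < n -> o < 2 * n ->
  row_addressable w memory L (4 * n.+1 + p * W) o /\
  row_bit w memory L (4 * n.+1 + p * W) o = code_bit c p o.
Proof.
move=> lt_pn lt_o; have L_gt0 : 0 < L by rewrite muln_gt0 l_gt0.
have lt_b : o %/ L < W by rewrite ltnS leq_div2r // ltnW.
have lt_i : o %% L %/ w < l by rewrite ltn_divLR // ltn_mod.
have le_t := index_size (p, o %/ L) blocks.
have ptrE : memory (4 * n.+1 + p * W + o %/ L) = pointer_word p (o %/ L).
  by rewrite memoryE nth_pointer_word.
split; first split; rewrite ?ptrE.
- by apply: leq_trans labels_fit; lia.
- apply: leq_trans fits; rewrite /words /compressed_size -!addnA ltn_add2l ltn_addr //.
  by rewrite ltn_rowmajor.
- apply: leq_trans fits; rewrite /words /compressed_size -!addnA !ltn_add2l.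
  by rewrite ltn_rowmajor.
rewrite /row_bit /mem_bit ptrE memoryE nth_block_word // /block_word.
have [in_blocks|notin] := boolP ((p, o %/ L) \in blocks).
  by rewrite nth_index // bit_row_word // -divn_eq.
rewrite memNindex // nth_default // bit_row_word //.
transitivity false; [apply/negbTE | apply/esym/negbTE].
  by apply/negP => /code_bit_lt; rewrite ltnn.
by apply: contra notin; apply: c_blocks.
Qed.

Lemma label_fieldsE a :
  [/\ rank_field memory (lab a) = rank a,
      row_field memory (lab a) = 4 * n.+1 + row_index c a * W,
      flag_field memory (lab a) = flag_column c a
    & offset_field memory (lab a) = offset_column c a].
Proof.
rewrite /rank_field -[lab a * 4]addn0.
by split; rewrite /row_field /flag_field /offset_field memoryE nth_label_word.
Qed.

Lemma header_word i : i < 4 -> memory i = nth 0 [:: w; 0; L; 0] i.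
Proof. by move=> lt_i4; rewrite memoryE /compressed_words -catA nth_cat ifT. Qed.

Lemma pair_bit_compressed a b :
  pair_addressable w memory (lab a) (lab b) /\
  pair_bit w memory (lab a) (lab b) =
    code_bit c (row_index c a) (flag_column c b) &&
    code_bit c (row_index c a) (offset_column c b).
Proof.
have [_ row_a _ _] := label_fieldsE a; have [_ _ flag_b offset_b] := label_fieldsE b.
have [lt_flag lt_offset] := column_lt c b.
rewrite /pair_addressable /pair_bit row_a flag_b offset_b !header_word //.
have [addr_flag ->] := row_bit_compressed (row_index_lt c a) lt_flag.
by have [addr_offset ->] := row_bit_compressed (row_index_lt c a) lt_offset.
Qed.

Hypothesis adj_sym : symmetric adj.

Lemma compressed_encodable :
  encodable (fun a b => (rank a < rank b) && adj a b) (words * w).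
Proof.
exists (bits_of_words w compressed_words) => [|a b].
  by rewrite size_bits_of_words size_compressed_words.
have lt_label x : lab x * 4 + 3 < 2 ^ w by have := lab_le x; move: labels_fit; lia.
apply: answers_of_computes => [|R [_ R1 R2 R9]]; first by move: labels_fit; lia.
have [addr_ab bit_ab] := pair_bit_compressed a b.
have [addr_ba bit_ba] := pair_bit_compressed b a.
have [rank_a row_a _ _] := label_fieldsE a; have [rank_b row_b _ _] := label_fieldsE b.
have adjE : adj a b = if row_field memory (lab b) < row_field memory (lab a)
    then pair_bit w memory (lab a) (lab b) else pair_bit w memory (lab b) (lab a).
  rewrite row_a row_b bit_ab bit_ba ltn_add2l ltn_mul2r /=.
  by case: ltnP => [/ltnW/code_bitE-> // | /code_bitE <-]; rewrite adj_sym.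
rewrite adjE -rank_a -rank_b -R1 -R2.
apply: computes_pair_bit; rewrite ?R1 ?R2 ?header_word //.
  exact: ltn_pack.
by move: labels_fit; lia.
Qed.

End Compressed.
End MemoryImages.

(** * Space *)

Section Space.
Local Open Scope nat_scope.

Lemma leq_exp_lg n : n <= 2 ^ lg n.
Proof. exact: up_logP. Qed.

Lemma lg_gt1 n : 2 < n -> 1 < lg n.
Proof.
move=> n_gt2; rewrite ltnNge; apply: contraL n_gt2 => lg_le1; rewrite -leqNgt.
by apply: leq_trans (leq_exp_lg n) _; rewrite (leq_pexp2l (n2 := 1)).
Qed.

Lemma leq_lg n : lg n <= n.
Proof. by apply: up_log_min => //; apply/ltnW/ltn_expl. Qed.

Lemma mul32_lg_leq l : 1024 <= l -> 32 * lg l <= l.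
Proof.
move=> l_large; have ten_le : 10 <= lg l by rewrite (leq_up_log 2 l_large).
apply: leq_trans (_ : 2 ^ (lg l).-1 <= l).
  rewrite -(subnK ten_le) addnS /= expnD; move: (lg l - 10) => k.
  by have := ltn_expl k (ltnSn 1); lia.
by rewrite ltnW // up_log_gtn // (leq_trans _ l_large).
Qed.

Lemma sqr_leq_exp_word n w : 2 * lg n <= w -> n ^ 2 <= 2 ^ w.
Proof.
move=> w_ge; apply: leq_trans (_ : 2 ^ (2 * lg n) <= _); last by rewrite leq_exp2l.
by rewrite mulnC expnM leq_exp2r // leq_exp_lg.
Qed.

Lemma matrix_size_leq n w : 2 < n -> 2 * lg n <= w -> matrix_size n w <= n ^ 2.
Proof.
move=> n_gt2 w_ge; have w_ge4 : 4 <= w by have := lg_gt1 n_gt2; lia.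
have := leq_div2l n (isT : 0 < 4) w_ge4; have := leq_trunc_div n 4.
by rewrite /matrix_size -mulnn; move: (n %/ w) (n %/ 4); nia.
Qed.

Lemma sum_ord_leq n : 2 * \sum_(p < n) p <= n ^ 2.
Proof.
rewrite -(big_mkord xpredT id) bin2_sum -(mul_bin_diag n 1) bin1 -mulnn.
by rewrite leq_mul2l leq_pred orbT.
Qed.

Lemma sum_dense_width n q :
  4 * q * \sum_(p < n) dense_width q p <= (q + 2) * (n ^ 2 + 4 * q * n).
Proof.
have width_le p : 2 * q * dense_width q p <= (q + 2) * (p + 2 * q).
  rewrite /dense_width mulnA mulnC leq_mul2l; apply/orP; right.
  by rewrite mulnC mulSn addnC leq_add2r leq_trunc_div.
have sum_le : 2 * q * \sum_(p < n) dense_width q p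
    <= (q + 2) * (\sum_(p < n) p + 2 * q * n).
  rewrite big_distrr; apply: (@leq_trans (\sum_(p < n) (q + 2) * (p + 2 * q))).
    by apply: leq_sum => p _; apply: width_le.
  by rewrite -big_distrr big_split sum_nat_const card_ord [n * _]mulnC.
by have := leq_mul (leqnn (q + 2)) (sum_ord_leq n); nia.
Qed.

(* The factor 16 makes chunk_size n ^ (biclique_size n).+1 at most n. *)
Definition biclique_size (n : nat) : nat := lg n %/ (16 * lg (lg n)).

Definition chunk_size (n : nat) : nat := lg n ^ 4.

Variable n : nat.
Let l := lg n.
Let ll := lg l.
Let q := biclique_size n.
Let s := chunk_size n.
Hypothesis l_large : 1024 <= l.

Let l_gt0 : 0 < l. Proof. exact: leq_trans l_large. Qed.

Let n_gt1 : 1 < n. Proof. by move: l_gt0; rewrite /l /lg up_log_gt0. Qed.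

Let ll_gt0 : 0 < ll.
Proof. by rewrite /ll /lg up_log_gt0; apply: leq_trans l_large. Qed.

Let ll_le : 32 * ll <= l. Proof. exact: mul32_lg_leq. Qed.

Lemma biclique_size_gt1 : 1 < q.
Proof. by rewrite /q /biclique_size -/l -/ll leq_divRL ?muln_gt0 ?ll_gt0 // mulnA. Qed.

Lemma biclique_size_leq : 16 * ll * q <= l.
Proof. by rewrite mulnC leq_trunc_div. Qed.

Lemma biclique_size_geq : l <= 32 * ll * q.
Proof.
have lt_l : l < 16 * ll * q.+1 by rewrite mulnC ltn_ceil // muln_gt0 ll_gt0.
apply: leq_trans (ltnW lt_l) _.
rewrite (_ : 32 * ll * q = 16 * ll * (q + q)); last by lia.
by rewrite leq_mul2l -[q.+1]addn1 leq_add2l ltnW ?biclique_size_gt1 ?orbT.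
Qed.

Lemma chunk_size_pow : s ^ q * s <= n.
Proof.
have -> : s ^ q * s = l ^ (4 * q.+1) by rewrite -expnSr /s -expnM.
apply: leq_trans (ltnW (up_log_gtn (ltnSn 1) n_gt1)).
apply: leq_trans (_ : 2 ^ (ll * (4 * q.+1)) <= _).
  by rewrite [leqRHS]expnM leq_exp2r // leq_exp_lg.
rewrite leq_exp2l //; move: biclique_size_gt1 biclique_size_leq ll_le l_large.
by rewrite -/(lg n) -/l; move: (q) (ll) (l); lia.
Qed.

Lemma lg_cube_leq : l ^ 3 <= n.
Proof.
apply: leq_trans chunk_size_pow; apply: leq_trans (_ : s <= _).
  by rewrite /s /chunk_size leq_pexp2l.
by rewrite leq_pmull // !expn_gt0 l_gt0.
Qed.

Let q_le : q <= l.
Proof. by rewrite (leq_trans _ biclique_size_leq) // leq_pmull // muln_gt0. Qed.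

Lemma dense_bits_leq :
  4 * l * \sum_(p < n) dense_width q p <= l * n ^ 2 + 72 * ll * n ^ 2.
Proof.
have q_gt1 := biclique_size_gt1; have q_gt0 := ltnW q_gt1.
have width_le : (q + 2) * l <= 2 * n.
  apply: leq_trans (_ : 2 * l ^ 3 <= _); last by rewrite leq_mul2l lg_cube_leq.
  by rewrite !expnS; move: q_le l_large; nia.
have linear_le : (q + 2) * l * (4 * q * n) <= 8 * (ll * q * n ^ 2).
  apply: leq_trans (leq_mul width_le (leqnn _)) _.
  have -> : 2 * n * (4 * q * n) = 8 * (q * n ^ 2) by rewrite -mulnn; lia.
  by rewrite leq_mul2l -mulnA leq_pmull.
have quadratic_le : 2 * l * n ^ 2 <= 64 * (ll * q * n ^ 2).
  have -> : 64 * (ll * q * n ^ 2) = 2 * (32 * ll * q) * n ^ 2 by lia.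
  by rewrite leq_mul2r leq_mul2l biclique_size_geq !orbT.
rewrite -(leq_pmul2l q_gt0); move: (leq_mul (leqnn l) (sum_dense_width n q)).
move: linear_le quadratic_le; move: (\sum_(p < n) _) (n ^ 2) => D n2; clear; lia.
Qed.

Lemma tail_blocks_leq : l ^ 3 * degree_sum_bound q n s <= 4 * n ^ 2.
Proof.
have s_gt0 : 0 < s by rewrite expn_gt0 l_gt0.
have chunk_le : n * q + s ^ q * q * s <= 2 * n * l.
  rewrite mulnAC -mulnDl leq_mul // mul2n -addnn leq_add2l.
  exact: chunk_size_pow.
have chunks_le : (n %/ s).+1 * s <= 2 * n.
  rewrite mulSn addnC mul2n -addnn leq_add ?leq_trunc_div //.
  by rewrite (leq_trans _ chunk_size_pow) // leq_pmull // expn_gt0 s_gt0.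
rewrite -(leq_pmul2l l_gt0) mulnA -expnS -/s /degree_sum_bound mulnA [s * _]mulnC.
apply: leq_trans (leq_mul chunks_le chunk_le) _.
by rewrite -mulnn; lia.
Qed.

Variables w K : nat.
Let L := l * w.
Hypotheses (K_gt0 : 0 < K) (w_ge : 2 * l <= w) (w_le : w <= K * l).

Let block_width_leq_cube : l * L <= K * l ^ 3.
Proof. by rewrite /L mulnA mulnn (expnSr l 2) [leqRHS]mulnCA leq_mul2l w_le orbT. Qed.

Lemma block_width_leq : l * L <= K * n.
Proof. by rewrite (leq_trans block_width_leq_cube) // leq_mul2l lg_cube_leq orbT. Qed.

Let L_le : L <= K * n.
Proof. by rewrite (leq_trans _ block_width_leq) // leq_pmull. Qed.

Lemma index_bits_leq :
  4 * l * ((4 * n.+1 + n * (2 * n %/ L).+1) * w) <= (36 * K + 8) * n ^ 2.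
Proof.
have labels_le : L * n.+1 <= 2 * K * n ^ 2.
  by rewrite -mulnn (leq_trans (leq_mul L_le (_ : n.+1 <= 2 * n))) //; move: n_gt1; lia.
have pointers_le : (2 * n %/ L).+1 * L <= (2 + K) * n.
  by rewrite mulSn addnC mulnDl leq_add ?leq_trunc_div.
have := leq_mul (leqnn n) pointers_le; move: labels_le.
by rewrite -mulnn /L; nia.
Qed.

Lemma block_bits_leq m : m <= block_count_bound n q L s ->
  4 * l * (m.+1 * l * w) <= l * n ^ 2 + 72 * ll * n ^ 2 + 24 * K * n ^ 2.
Proof.
rewrite /block_count_bound => m_le.
have dense_le : (\sum_(p < n) (dense_width q p %/ L).+1) * L
    <= \sum_(p < n) dense_width q p + n * L.
  rewrite big_distrl -[in n * L](card_ord n) -sum_nat_const -big_split.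
  by apply: leq_sum => p _; rewrite /= mulSn addnC leq_add2r leq_trunc_div.
have tail_le : l * L * degree_sum_bound q n s <= 4 * K * n ^ 2.
  apply: leq_trans (leq_mul block_width_leq_cube (leqnn _)) _.
  by rewrite -mulnA (leq_trans (leq_mul (leqnn K) tail_blocks_leq)) // mulnCA mulnA.
have width_le : n * (l * L) <= K * n ^ 2.
  by rewrite -mulnn [leqRHS]mulnCA leq_mul2l block_width_leq orbT.
have default_le : l * L <= K * n ^ 2.
  by rewrite (leq_trans _ width_le) // leq_pmull // ltnW.
have := leq_mul (leqnn l) (leq_mul m_le (leqnn L)).
have := leq_mul (leqnn l) dense_le; move: dense_bits_leq tail_le width_le default_le.
move: (degree_sum_bound q n s) (n ^ 2) (\sum_(p < n) dense_width q p) (\sum_(p < n) _).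
by move=> tail n2 dense blocks; rewrite /L; clear; nia.
Qed.

Lemma compressed_bits_leq m : m <= block_count_bound n q L s ->
  4 * l * (compressed_size n w l m * w) <= l * n ^ 2 + 140 * K * ll * n ^ 2.
Proof.
move=> m_le; rewrite /compressed_size mulnDl mulnDr.
apply: leq_trans (leq_add index_bits_leq (block_bits_leq m_le)) _.
rewrite addnCA -!addnA leq_add2l -!mulnDl leq_mul2r; apply/orP; right.
by have := leq_pmulr K ll_gt0; have := leq_pmull ll K_gt0; lia.
Qed.

Hypothesis l_geK : 5 * K + 1 <= l.

Lemma compressed_size_leq m : m <= block_count_bound n q L s ->
  compressed_size n w l m <= n ^ 2.
Proof.
move=> m_le; have w_gt0 : 0 < w by rewrite (leq_trans _ w_ge) ?muln_gt0.
rewrite -(leq_pmul2r w_gt0) -(@leq_pmul2l (4 * l)) ?muln_gt0 //.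
apply: leq_trans (compressed_bits_leq m_le) _.
apply: leq_trans (_ : l * (5 * K + 1) * n ^ 2 <= _).
  rewrite -mulnDl leq_mul2r; apply/orP; right.
  by have := leq_mul (leqnn (5 * K)) ll_le; lia.
rewrite [n ^ 2 * w]mulnC mulnA leq_mul2r; apply/orP; right.
by move: w_ge l_geK; nia.
Qed.

Lemma block_width_leq_n : L <= n.
Proof.
rewrite -(leq_pmul2l l_gt0) (leq_trans block_width_leq) // leq_mul2r.
by apply/orP; right; apply: leq_trans l_geK; rewrite addn1 leqW // leq_pmull.
Qed.

End Space.

(** * Transitive reductions *)

Section TransitiveReduction.
Local Open Scope nat_scope.
Variables (d : Order.disp_t) (T : finPOrderType d).
Implicit Types a b c : T.

Definition down_card (a : T) : nat := #|[set c | (c <= a)%O]|.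

Lemma down_card_lt a b : (a < b)%O -> down_card a < down_card b.
Proof.
move=> lt_ab; apply/proper_card/properP; split.
  by apply/subsetP => c; rewrite !inE => /le_trans; apply; apply: ltW.
by exists b; rewrite inE ?lexx // lt_geF.
Qed.

Lemma trans_red_lt a b : trans_red a b -> (a < b)%O.
Proof. by case/andP. Qed.

Lemma trans_red_asym a b : trans_red a b -> ~~ trans_red b a.
Proof. by move/trans_red_lt => lt_ab; apply/negP => /trans_red_lt; rewrite lt_gtF. Qed.

Lemma trans_red_no_shortcut a b c : trans_red a b -> trans_red b c -> ~~ trans_red a c.
Proof.
move=> /trans_red_lt lt_ab /trans_red_lt lt_bc; rewrite negb_and negbK.
by apply/orP; right; apply/existsP; exists b; rewrite lt_ab.
Qed.

Lemma trans_red_no_cycle a b c : trans_red a b -> trans_red b c -> ~~ trans_red c a.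
Proof.
move=> /trans_red_lt lt_ab /trans_red_lt lt_bc; apply/negP => /trans_red_lt.
by rewrite lt_gtF // (lt_trans lt_ab).
Qed.

Definition cover_adj : rel T := fun a b => trans_red a b || trans_red b a.

Lemma cover_adj_sym : symmetric cover_adj.
Proof. by move=> a b; rewrite /cover_adj orbC. Qed.

Lemma cover_adj_irr : irreflexive cover_adj.
Proof. by move=> a; apply/negbTE; rewrite /cover_adj orbb /trans_red ltxx. Qed.

Lemma cover_adj_triangle a b c : cover_adj a b -> cover_adj b c -> ~~ cover_adj a c.
Proof.
rewrite negb_or => /orP[] ab /orP[] bc; apply/andP; split.
- exact: trans_red_no_shortcut ab bc.
- exact: trans_red_no_cycle ab bc.
- by apply: contraL ab => ac; apply: trans_red_no_shortcut ac bc.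
- by apply: contraL bc => ca; apply: trans_red_no_shortcut ca ab.
- by apply: contraL bc => ac; apply: trans_red_no_shortcut ab ac.
- by apply: contraL ab => ca; apply: trans_red_no_shortcut bc ca.
- exact: trans_red_no_cycle bc ab.
- exact: trans_red_no_shortcut bc ab.
Qed.

Lemma trans_redE a b : trans_red a b = (down_card a < down_card b) && cover_adj a b.
Proof.
apply/idP/andP => [ab|[lt_ab /orP[//|/trans_red_lt/down_card_lt lt_ba]]].
  by rewrite /cover_adj ab; split=> //; apply/down_card_lt/trans_red_lt.
by have := ltn_trans lt_ab lt_ba; rewrite ltnn.
Qed.

Variables (lab : T -> nat) (w K : nat).
Local Notation n := #|T|.
Hypothesis labP : labelling n lab.
Hypotheses (w_ge : 2 * lg n <= w) (w_le : w <= K * lg n).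

Lemma large_trans_red_encodable : 0 < K -> 1024 <= lg n -> 5 * K + 1 <= lg n ->
  exists2 m, encodable lab w (@trans_red d T) m &
    4 * lg n * m <= lg n * n ^ 2 + 140 * K * lg (lg n) * n ^ 2.
Proof.
move=> K_gt0 l_large l_geK; have l_gt0 : 0 < lg n by apply: leq_trans l_large.
have n_gt1 : 1 < n by move: l_gt0; rewrite /lg up_log_gt0.
have w_gt1 : 1 < w by move: w_ge l_gt0; lia.
have chunk_gt0 : 0 < chunk_size n by rewrite expn_gt0 l_gt0.
have [c [blocks [c_blocks blocks_le]]] :=
  triangle_free_row_code cover_adj_irr cover_adj_triangle (ltnW n_gt1)
    (lg n * w) (biclique_size_gt1 l_large) chunk_gt0.
have n2_le := sqr_leq_exp_word w_ge.
have words_le := compressed_size_leq l_large K_gt0 w_ge w_le l_geK blocks_le.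
have block_lt : lg n * w < 2 ^ w.
  apply: leq_trans n2_le; rewrite -mulnn.
  apply: leq_ltn_trans (block_width_leq_n l_large w_le l_geK) _.
  by rewrite -[X in X < _]muln1 ltn_pmul2l // ltnW.
have [B size_B ansB] := compressed_encodable labP w_gt1 l_gt0 (leq_trans words_le n2_le)
  block_lt c_blocks (rank := down_card) (fun a => max_card _) cover_adj_sym.
exists (compressed_size n w (lg n) (size blocks) * w).
  by exists B => // a b; rewrite trans_redE.
exact: compressed_bits_leq.
Qed.

Lemma small_trans_red_encodable l0 : 2 < n -> lg n < l0 ->
  exists2 m, encodable lab w (@trans_red d T) m & m <= (2 + (2 ^ l0).+1 ^ 2) * (K * l0).
Proof.
move=> n_gt2 lg_lt; have w_gt1 : 1 < w by have := lg_gt1 n_gt2; move: w_ge; lia.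
exists (matrix_size n w * w).
  apply: matrix_encodable => //.
  exact: leq_trans (matrix_size_leq n_gt2 w_ge) (sqr_leq_exp_word w_ge).
have n_le : n <= 2 ^ l0 by rewrite (leq_trans (leq_exp_lg n)) // leq_exp2l // ltnW.
apply: leq_mul; last by rewrite (leq_trans w_le) // leq_mul2l ltnW ?orbT.
by rewrite leq_add2l -mulnn leq_mul // ltnS // (leq_trans (leq_div _ _)).
Qed.

End TransitiveReduction.

Lemma trans_red_encodable (K : nat) : (0 < K)%N ->
  exists2 c : nat, (0 < c)%N &
    forall (d : Order.disp_t) (T : finPOrderType d) (lab : T -> nat) (w : nat),
      (1 < #|T|)%N -> labelling #|T| lab ->
      (2 * lg #|T| <= w)%N -> (w <= K * lg #|T|)%N ->
    exists2 m, encodable lab w (@trans_red d T) m &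
      (4 * lg #|T| * m <= lg #|T| * #|T| ^ 2 + 4 * c * lg (lg #|T|) * #|T| ^ 2)%N.
Proof.
move=> K_gt0; pose l0 := maxn 1024 (5 * K + 1).
pose c_small := ((2 + (2 ^ l0).+1 ^ 2) * (K * l0))%N.
exists (35 * K + c_small)%N => [|d T lab w n_gt1 labP w_ge w_le].
  by rewrite addn_gt0 muln_gt0 K_gt0.
have [n_eq2|n_ne2] := eqVneq #|T| 2%N.
  have w_gt1 : (1 < w)%N by move: w_ge; rewrite n_eq2.
  exists 1%N; last by rewrite n_eq2.
  apply: (two_element_encodable labP w_gt1 _ n_eq2); exact: trans_red_asym.
have {n_ne2} n_gt2 : (2 < #|T|)%N by rewrite ltn_neqAle eq_sym n_ne2.
have [|lg_lt] := leqP l0 (lg #|T|).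
  rewrite geq_max => /andP[l_large l_geK].
  have [m enc_m m_le] := large_trans_red_encodable labP w_ge w_le K_gt0 l_large l_geK.
  exists m => //; apply: leq_trans m_le _; rewrite leq_add2l !leq_mul2r.
  by rewrite mulnDr mulnA leq_addr !orbT.
have [m enc_m m_le] := small_trans_red_encodable labP w_ge w_le n_gt2 lg_lt.
exists m => //; apply: leq_trans (leq_addl _ _).
have ll_gt0 : (0 < lg (lg #|T|))%N by rewrite /lg up_log_gt0 lg_gt1.
have l_le : (lg #|T| <= #|T| ^ 2)%N.
  by rewrite (leq_trans (leq_lg _)) // -mulnn leq_pmull // ltnW.
rewrite -!mulnA leq_mul2l /= mulnC; apply: leq_mul.
  exact: leq_trans m_le (leq_addl _ _).
by rewrite (leq_trans l_le) // leq_pmull.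
Qed.

Lemma space_bound (c l ll n m : nat) : (0 < l)%N ->
  (4 * l * m <= l * n ^ 2 + 4 * c * ll * n ^ 2)%N ->
  m%:R <= n%:R ^+ 2 / 4%:R + c%:R * (n%:R ^+ 2 * ll%:R / l%:R) :> rat.
Proof.
move=> l_gt0 m_le; have l_neq0 : l%:R != 0 :> rat by rewrite pnatr_eq0 -lt0n.
rewrite -(@ler_pM2l _ (4 * l)%N%:R) ?ltr0n ?muln_gt0 // -natrM.
move: m_le; rewrite -(ler_nat rat) => /le_trans; apply.
by rewrite natrD !natrM le_eqVlt; apply/orP; left; apply/eqP; field.
Qed.

Theorem theorem2 (w : nat -> nat) (hw : word_size_Theta_lg w) :
  exists (c : rat) (t : nat) (p : program),
    0 < c /\
    forall n : nat, (2 <= n)%N ->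
    forall (d : Order.disp_t) (T : finPOrderType d), #|T| = n ->
    forall lab : T -> nat, labelling n lab ->
    exists B : seq bool,
      (size B)%:R <= n%:R ^+ 2 / 4%:R
                     + c * (n%:R ^+ 2 * (lg (lg n))%:R / (lg n)%:R) /\
      forall a b : T, answers (w n) p t B (lab a) (lab b) (trans_red a b).
Proof.
have [w_ge [K w_le]] := hw.
have [c c_gt0 encode] := trans_red_encodable (ltn0Sn K).
exists c%:R, query_time, query_program; split; first by rewrite ltr0n.
move=> n n_ge2 d T def_n lab; rewrite -{n}def_n in n_ge2 * => labP.
have w_leS : (w #|T| <= K.+1 * lg #|T|)%N.
  by rewrite (leq_trans (w_le _ n_ge2)) // leq_mul2r leqnSn orbT.
have [m [B size_B ansB] m_le] :=
  encode d T lab (w #|T|) n_ge2 labP (w_ge _ n_ge2) w_leS.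
exists B; split=> //; rewrite -(ler_nat rat) in size_B; apply: le_trans size_B _.
by apply: space_bound m_le; rewrite /lg up_log_gt0.
Qed.
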